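(* Let $n\in\mathbb{N}$ and let $\mathbf{s}=(s_0,\ldots,s_n)\subset[0,\infty)$ be strictly positive on $(0,\infty)$. Let $r\ge1$ be an integer and $K\in\mathbb{N}\cap\left[\left\lceil\frac{n+1}{2}\right\rceil,\left\lceil\frac{n+r+1}{2}\right\rceil\right]$; put $N=2K-1$. Let $s_{-r},\ldots,s_{-1}\in[0,\infty)$ satisfy (i) $s_k\in\big(t_\infty((s_{k+1},\ldots,s_0,s_1,\ldots,s_n)),\infty\big)$ for $k\in\mathbb{Z}\cap[n-N,-1]$, and (ii) $s_k=t_\infty((s_{k+1},\ldots,s_{k+N+1}))$ for $k\in\mathbb{Z}\cap[-r,n-N-1]$. Then $\mathbf{s}'=(s_{-r},s_{-r+1},\ldots,s_n)$ (with $s_{-r}$ as its zeroth term) is positive on $(0,\infty)$ and $\mathrm{ind}_\infty(\mathbf{s}')=K$. Moreover, if $N\le n+r$, then the measure $\mu\in\mathcal{M}_\infty(\mathbf{s}')$ with $\#\mathrm{supp}\,\mu=K$ is unique and its atoms are the roots of $Q(t)=\det\begin{bmatrix} s_{-r}&s_{-r+1}&\cdots&s_{-r+K-1}&1\\ s_{-r+1}&s_{-r+2}&\cdots&s_{-r+K}&t\\ \vdots&&&&\vdots\\ s_{-r+K}&s_{-r+K+1}&\cdots&s_{-r+2K-1}&t^K\end{bmatrix}$.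
   Context: For $a<b$ and a finite sequence $\mathbf{u}=(u_0,\ldots,u_m)$, let $\sigma(x^k)=u_k$ on real polynomials of degree $\le m$. $\mathbf{u}$ is positive on $[a,b]$ if $\sigma(P)\ge0$ for all such $P\ge0$ on $[a,b]$, strictly positive if moreover $\sigma(P)>0$ whenever $P\not\equiv0$. Positive/strictly positive on $(0,\infty)$ means positive/strictly positive on some $[a,b]\subset(0,\infty)$. $\mathcal{M}_{a,b}(\mathbf{u})$: positive Borel measures on $[a,b]$ with $k$-th moments $u_k$; $\mathcal{M}_\infty(\mathbf{u})$: positive Borel measures on $(0,\infty)$ supported in a compact subinterval of $(0,\infty)$ with $k$-th moments $u_k$, $k\le m$; $\mathrm{ind}_\infty(\mathbf{u})=\min\{\#\mathrm{supp}\,\mu:\mu\in\mathcal{M}_\infty(\mathbf{u})\}$. $t_{a,b}(\mathbf{u})=\inf\{\int\frac1t\,d\mu:\mu\in\mathcal{M}_{a,b}(\mathbf{u})\}$ ($\inf\varnothing=\infty$), $t_\infty(\mathbf{u})=\inf_{0<a<b}t_{a,b}(\mathbf{u})$. *)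

(* Defs.v *)
From HB Require Import structures.
From mathcomp Require Import all_boot all_order all_algebra.
From mathcomp Require Import all_classical all_reals all_analysis.
Set Implicit Arguments. Unset Strict Implicit. Unset Printing Implicit Defensive.
Import Order.TTheory GRing.Theory Num.Theory.
Import numFieldNormedType.Exports.
Local Open Scope classical_set_scope.
Local Open Scope ring_scope.

Section Defs.
Variable R : realType.

(* A finite sequence u = (u_0,...,u_m) is a list of size m+1.
   Riesz functional: sigma(P) = sum_k P_k u_k, for P of degree <= m. *)
Definition riesz (u : seq R) (P : {poly R}) : R :=
  \sum_(k < size u) P`_k * u`_k.

Definition nonneg_on (a b : R) (P : {poly R}) : Prop :=
  forall t, a <= t <= b -> 0 <= P.[t].

Definition positive_on (a b : R) (u : seq R) : Prop :=
  forall P : {poly R}, (size P <= size u)%N -> nonneg_on a b P -> 0 <= riesz u P.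

Definition strictly_positive_on (a b : R) (u : seq R) : Prop :=
  positive_on a b u /\
  forall P : {poly R}, (size P <= size u)%N -> nonneg_on a b P -> P != 0 ->
    0 < riesz u P.

Definition positive_infty (u : seq R) : Prop :=
  exists a b : R, 0 < a /\ a < b /\ positive_on a b u.

Definition strictly_positive_infty (u : seq R) : Prop :=
  exists a b : R, 0 < a /\ a < b /\ strictly_positive_on a b u.

Definition in_M_ab (a b : R) (u : seq R) (mu : {measure set R -> \bar R}) : Prop :=
  mu (~` `[a, b]) = 0%E /\
  forall k : nat, (k < size u)%N ->
    (\int[mu]_(x in `[a, b]) (x ^+ k)%:E = (u`_k)%:E)%E.

Definition in_M_infty (u : seq R) (mu : {measure set R -> \bar R}) : Prop :=
  exists a b : R, 0 < a /\ a < b /\ in_M_ab a b u mu.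

Definition msupp (mu : {measure set R -> \bar R}) : set R :=
  [set x : R | forall e : R, 0 < e -> (0 < mu [set` `](x - e)%R, (x + e)%R[])%E].

Definition supp_card (mu : {measure set R -> \bar R}) (K : nat) : Prop :=
  exists s : seq R, uniq s /\ size s = K /\ msupp mu = [set` s].

Definition supp_card_le (mu : {measure set R -> \bar R}) (n : nat) : Prop :=
  exists s : seq R, (size s <= n)%N /\ msupp mu `<=` [set` s].

Definition ind_infty_eq (u : seq R) (K : nat) : Prop :=
  (exists mu, in_M_infty u mu /\ supp_card mu K) /\
  (forall mu n, in_M_infty u mu -> supp_card_le mu n -> (K <= n)%N).

Definition t_ab (a b : R) (u : seq R) : \bar R :=
  ereal_inf [set (\int[mu]_(x in `[a, b]) (x^-1)%:E)%E
            | mu in [set mu | in_M_ab a b u mu]].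

Definition t_infty (u : seq R) : \bar R :=
  ereal_inf [set x : \bar R | exists a b : R, 0 < a /\ a < b /\ x = t_ab a b u].

Definition sq (s : int -> R) (i : int) (len : nat) : seq R :=
  mkseq (fun k => s (i + k%:Z)) len.

Definition Qdet (s : int -> R) (r K : nat) (t : R) : R :=
  \det (\matrix_(i < K.+1, j < K.+1)
          if (j < K)%N then s (- r%:Z + i%:Z + j%:Z) else t ^+ i).

End Defs.

(* Main.v *)
Require Import Defs.
From HB Require Import structures.
From mathcomp Require Import all_boot all_order all_algebra.
From mathcomp Require Import all_classical all_reals all_analysis.
From mathcomp Require Import measurable_realfun complex ring lra zify.
Set Implicit Arguments. Unset Strict Implicit. Unset Printing Implicit Defensive.
Import Order.TTheory GRing.Theory Num.Theory.
Import numFieldNormedType.Exports.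
Local Open Scope classical_set_scope.
Local Open Scope ring_scope.

(* Positive definiteness of the Hankel forms [L(P^2)] and [L(t P^2)], where [L] is
   the Riesz functional, replaces strict positivity on a compact subinterval of
   (0, oo).  Prepending [c > t_oo(u)] preserves it: a measure [nu] with moments [u]
   and [T := int 1/t dnu < c] gives
   [L'(P^2) = int P^2/t dnu + P(0)^2 (c - T)].  With 2K moments, the orthogonal
   polynomial [p] of degree [K] has [K] simple positive roots, which yields a
   [K]-atomic Gauss measure [mu]; a sequence of 2K-1 moments is first extended by
   one large moment in front.  Since [1/t >= (1 - (p(t)/p(0))^2)/t] with equality at
   the atoms, [t_oo = int 1/t dmu], so each prepended minimal moment replaces [mu]
   by [mu/t] and keeps the [K] atoms.  Fewer than [K] atoms are impossible because
   [L] would vanish on the square of the polynomial vanishing at them, and a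
   [K]-atomic measure is determined by its atoms, which are the roots of [Q]. *)

(** * Riesz functionals and the positivity of their Hankel forms *)

Section RieszFunctional.
Variable R : realType.
Implicit Types (u v xs : seq R) (P Q : {poly R}).

Lemma riesz_is_scalar u : scalar (riesz u).
Proof.
move=> a P Q; rewrite /riesz mulr_sumr -big_split; apply: eq_bigr => k _ /=.
by rewrite coefD coefZ mulrDl mulrA.
Qed.

HB.instance Definition _ u :=
  GRing.isLinear.Build R {poly R} R^o _ (riesz u) (riesz_is_scalar u).

Lemma riesz_cons c u (a : R) Q :
  riesz (c :: u) (a%:P + 'X * Q) = a * c + riesz u Q.
Proof.
rewrite /riesz big_ord_recl /= coefD coefC coefXM /= addr0; congr (_ + _).
by apply: eq_bigr => k _; rewrite coefD coefC coefXM /= add0r.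
Qed.

Lemma riesz_consX c u Q : riesz (c :: u) ('X * Q) = riesz u Q.
Proof. by rewrite -[X in riesz _ X]add0r -polyC0 riesz_cons mul0r add0r. Qed.

Lemma riesz_drop m u Q : riesz (drop m u) Q = riesz u ('X^m * Q).
Proof.
elim: m u => [|m IHm] [|c u].
- by rewrite drop0 expr0 mul1r.
- by rewrite drop0 expr0 mul1r.
- by rewrite /riesz !big_ord0.
- by rewrite /= IHm exprS -mulrA riesz_consX.
Qed.

(** Weights are a function of the atom, of arbitrary sign: passing from a measure [mu] to [mu/t] or
    [t mu] changes [w] alone and keeps [xs]. *)
Definition represents (w : R -> R) xs u :=
  forall k, (k < size u)%N -> u`_k = \sum_(x <- xs) w x * x ^+ k.

Lemma riesz_represents w xs u P : represents w xs u ->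
  (size P <= size u)%N -> riesz u P = \sum_(x <- xs) w x * P.[x].
Proof.
move=> wE sP; rewrite /riesz.
under eq_bigr => k _ do rewrite wE // mulr_sumr.
rewrite exchange_big; apply: eq_bigr => x _ /=.
rewrite (horner_coef_wide x sP) mulr_sumr.
by apply: eq_bigr => k _; ring.
Qed.

Lemma poly_const_addX P : exists Q, P = (P.[0])%:P + 'X * Q.
Proof.
have : root (P - (P.[0])%:P) 0 by rewrite /root !hornerE subrr.
move=> /factor_theorem[Q QE]; exists Q.
by rewrite mulrC -[X in _ * X]subr0 -polyC0 -QE addrC subrK.
Qed.

Lemma size_addX_le (a : R) Q m : (size (a%:P + 'X * Q)%R <= m.+1)%N -> (size Q <= m)%N.
Proof.
move=> /leq_sizeP h; apply/leq_sizeP => j mj.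
by have := h j.+1 mj; rewrite coefD coefC coefXM /= add0r.
Qed.

Lemma size_sqr_le P m : (size P * 2 <= m.+1)%N -> (size (P ^+ 2)%R <= m)%N.
Proof.
move=> sP; have := size_polyMleq P P; rewrite -expr2 => /leq_trans; apply.
lia.
Qed.

(** For [u = (u_0, ..., u_m)] the size bounds read [2 deg P <= m] and [2 deg P + 1 <= m]; in this
    doubled form no case split on the parity of [m] is needed. *)
Definition hankel_pos u :=
  (forall P, P != 0 -> (size P * 2 <= (size u).+1)%N -> 0 < riesz u (P ^+ 2)) /\
  (forall P, P != 0 -> (size P * 2 <= size u)%N -> 0 < riesz u ('X * P ^+ 2)).

(** Squares are nonnegative everywhere, and ['X * P ^+ 2] is nonnegative on [[a, b]] because
    [0 < a]. *)
Lemma strictly_positive_hankel u : strictly_positive_infty u -> hankel_pos u.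
Proof.
move=> [a [b [a0 [ab [_ H]]]]]; split => P P0 sP; apply: H.
- exact: size_sqr_le.
- by move=> t _; rewrite horner_exp sqr_ge0.
- by rewrite expf_neq0.
- rewrite mulrC; have := size_polyMleq (P ^+ 2) 'X; rewrite size_polyX.
  move=> /leq_trans; apply; rewrite addn2 /=.
  case: (size u) sP => [|m] sP; last by rewrite ltnS; exact: size_sqr_le.
  by move: sP; rewrite leqn0 muln_eq0 size_poly_eq0 (negPf P0).
- move=> t /andP[at_ _]; rewrite hornerM hornerX horner_exp.
  by rewrite mulr_ge0 ?sqr_ge0 // (le_trans (ltW a0)).
- by rewrite mulf_neq0 ?polyX_eq0 ?expf_neq0.
Qed.

(** The second form of [c :: v] is the first form of [v], so a new front term only affects the
    condition on squares. *)
Lemma hankel_pos_cons c v : hankel_pos v ->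
  (forall P, P != 0 -> (size P * 2 <= (size v).+2)%N -> 0 < riesz (c :: v) (P ^+ 2)) ->
  hankel_pos (c :: v).
Proof.
move=> [v1 v2] h; split => [//|P P0 sP].
by rewrite riesz_consX; exact: v1.
Qed.

Lemma rVpoly_sum d (x : 'rV[R]_d) : rVpoly x = \sum_(i < d) x 0 i *: 'X^i.
Proof.
rewrite {1}[x]row_sum_delta linear_sum.
by apply: eq_bigr => i _; rewrite linearZ /= rVpoly_delta.
Qed.

(** Riesz representation for the inner product [(P, Q) -> L(P Q)], whose Gram matrix [H] is
    invertible by positive definiteness. It supplies both the Schur complement and the orthogonal
    polynomial below. *)
Lemma riesz_rep u u' d :
  (forall P, P != 0 -> (size P <= d)%N -> 0 < riesz u (P ^+ 2)) ->
  exists2 g : {poly R}, (size g <= d)%N &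
    forall P, (size P <= d)%N -> riesz u (g * P) = riesz u' P.
Proof.
move=> upos.
pose H := \matrix_(i < d, j < d) riesz u ('X^i * 'X^j).
pose b := \row_(j < d) riesz u' 'X^j.
have HE (x : 'rV[R]_d) j : (x *m H) 0 j = riesz u (rVpoly x * 'X^j).
  rewrite mxE rVpoly_sum mulr_suml linear_sum /=.
  apply: eq_bigr => i _; rewrite mxE -scalerAl linearZ /=.
  by [].
have HE2 (x : 'rV[R]_d) P : (size P <= d)%N ->
    riesz u (rVpoly x * P) = \sum_(j < d) P`_j * (x *m H) 0 j.
  move=> sP; rewrite -{1}[P](poly_rV_K sP) [rVpoly (poly_rV P)]rVpoly_sum.
  rewrite mulr_sumr linear_sum /=; apply: eq_bigr => j _.
  by rewrite -scalerAr linearZ /= HE mxE.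
have Hu : H \in unitmx.
  rewrite -row_free_unit; apply: inj_row_free => x xH.
  apply/eqP/negPn/negP => x0.
  have rx0 : rVpoly x != 0.
    by apply: contra x0 => /eqP e; rewrite -[x]rVpolyK e linear0.
  have := upos _ rx0 (size_poly _ _).
  rewrite expr2 HE2 ?size_poly // xH big1 ?ltxx // => j _.
  by rewrite mxE mulr0.
exists (rVpoly (b *m invmx H)); first exact: size_poly.
move=> P sP; rewrite HE2 // mulmxKV //.
rewrite -{2}[P](poly_rV_K sP) [rVpoly (poly_rV P)]rVpoly_sum linear_sum.
by apply: eq_bigr => j _; rewrite linearZ /= !mxE.
Qed.

(* Completing the square in the Schur complement of the new corner entry. *)
Lemma hankel_pos_extend v : odd (size v) -> hankel_pos v ->
  exists c, hankel_pos (c :: v).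
Proof.
case: v => [//|v0 v'] /= odd_v hv; set v := v0 :: v' in hv *.
have v'pos P : P != 0 -> (size P <= (size v' %/ 2))%N -> 0 < riesz v' (P ^+ 2).
  move=> P0 sP; rewrite -(riesz_consX v0); apply: hv.2 => //=.
  by move: sP; rewrite /v /=; lia.
have [g sg gE] := riesz_rep v v'pos.
have v'ge0 P : (size P <= (size v' %/ 2))%N -> 0 <= riesz v' (P ^+ 2).
  by have [->|P0] := eqVneq P 0; [rewrite expr0n /= linear0|move=> /(v'pos _ P0)/ltW].
(* The Schur complement is [c - riesz v' (g ^+ 2)], so any larger entry would do; the excess 1 is
   arbitrary. *)
exists (riesz v' (g ^+ 2) + 1); apply: hankel_pos_cons => // P P0 sP.
have [Q PE] := poly_const_addX P; set a := P.[0] in PE.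
(* Since [size v] is odd, the bound on [P] keeps [Q] within the degrees on which [g] represents
   [riesz v]. *)
have sQ : (size Q <= (size v' %/ 2))%N.
  by apply: (@size_addX_le a); rewrite -PE; move: sP => /=; lia.
have -> : P ^+ 2 = (a ^+ 2)%:P + 'X * (a *: Q *+ 2 + 'X * Q ^+ 2).
  by rewrite PE polyC_exp -mul_polyC; ring.
rewrite riesz_cons linearD linearMn linearZ /= -(gE Q sQ) riesz_consX.
have -> : a ^+ 2 * (riesz v' (g ^+ 2) + 1) +
    ((a * riesz v' (g * Q)) *+ 2 + riesz v' (Q ^+ 2)) =
    a ^+ 2 + riesz v' ((Q + a *: g) ^+ 2).
  rewrite sqrrD -scalerAr exprZn mulr2n !linearD /= !linearZ /=.
  by rewrite [Q * g]mulrC; ring.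
have sQg : (size (Q + a *: g)%R <= (size v' %/ 2))%N.
  rewrite (leq_trans (size_polyD _ _)) // geq_max sQ /=.
  by rewrite (leq_trans (size_scale_leq _ _)).
have [a0|a0] := eqVneq a 0.
  rewrite a0 expr0n add0r scale0r addr0; apply: v'pos => //.
  by apply: contra P0 => /eqP Q0; rewrite PE Q0 a0 mulr0 addr0 polyC0.
by apply: ltr_pwDl; [rewrite exprn_even_gt0|exact: v'ge0].
Qed.

(* [T] plays the role of the integral of [1/t] for a measure with moments [v]. *)
Lemma hankel_pos_prepend (a b : R) v T c : 0 < a -> hankel_pos v ->
  (forall Q (m : R), (size Q <= size v)%N ->
     (forall t, a <= t <= b -> 0 <= Q.[t] + m * t^-1) -> 0 <= riesz v Q + m * T) ->
  T < c -> hankel_pos (c :: v).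
Proof.
move=> a_gt0 hv HT Tc; apply: hankel_pos_cons => // P P0 sP.
have [Q PE] := poly_const_addX P; set m := P.[0] in PE.
pose S := m *: Q *+ 2 + 'X * Q ^+ 2.
have PE2 : P ^+ 2 = (m ^+ 2)%:P + 'X * S.
  by rewrite /S PE polyC_exp -mul_polyC; ring.
rewrite PE2 riesz_cons.
(* If [m = 0], then [P = 'X * Q] and the second Hankel form of [v] applies. Otherwise
   [P^2 / t = S + m^2 / t] gives [riesz v S + m^2 T >= 0], and the excess [m^2 (c - T)] is
   positive. *)
have [m0|m0] := eqVneq m 0.
  rewrite m0 expr0n mul0r add0r /S m0 scale0r mul0rn add0r.
  apply: hv.2.
    by apply: contra P0 => /eqP Q0; rewrite PE Q0 m0 mulr0 addr0 polyC0.
  have : (size Q <= (size P).-1)%N.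
    by apply: (@size_addX_le m); rewrite -PE; case: (size P).
  by have := size_poly_gt0 P; rewrite P0; lia.
have sS : (size S <= size v)%N.
  by apply: (@size_addX_le (m ^+ 2)); rewrite -PE2; apply: size_sqr_le.
have : 0 <= riesz v S + m ^+ 2 * T.
  apply: HT => // t /andP[at_ _]; have t0 : 0 < t by exact: lt_le_trans at_.
  have -> : S.[t] + m ^+ 2 * t^-1 = (P ^+ 2).[t] * t^-1.
    by rewrite PE2 hornerD hornerM hornerX hornerC; field; rewrite gt_eqF.
  by rewrite horner_exp mulr_ge0 ?sqr_ge0 // invr_ge0 ltW.
have : 0 < m ^+ 2 * (c - T) by rewrite mulr_gt0 ?subr_gt0 // exprn_even_gt0.
by rewrite mulrBr; lra.
Qed.

(* [p(t)^2 / (p(0)^2 t) >= 0] bounds [1/t] from below by a polynomial that agrees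
   with it at the atoms. *)
Lemma represents_inv_le (a b : R) v T w xs : 0 < a ->
  (size xs * 2 <= size v)%N -> (forall x, x \in xs -> 0 < x) ->
  represents w xs v ->
  (forall Q (m : R), (size Q <= size v)%N ->
     (forall t, a <= t <= b -> 0 <= Q.[t] + m * t^-1) -> 0 <= riesz v Q + m * T) ->
  \sum_(x <- xs) w x * x^-1 <= T.
Proof.
move=> a_gt0 sv xs_gt0 wE HT.
pose p := \prod_(x <- xs) ('X - x%:P); pose m := p.[0].
have m0 : m != 0.
  rewrite -/(root p 0) root_prod_XsubC; apply/negP => /xs_gt0.
  by rewrite ltxx.
have m2 : 0 < m ^+ 2 by rewrite exprn_even_gt0.
have [S pE] := poly_const_addX (p ^+ 2).
have sS : (size S <= size v)%N.
  apply: (@size_addX_le (p ^+ 2).[0]); rewrite -pE; apply: size_sqr_le.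
  by rewrite size_prod_XsubC; lia.
rewrite horner_exp -/m in pE.
have SE x : x != 0 -> S.[x] = (p.[x] ^+ 2 - m ^+ 2) * x^-1.
  move=> x0; rewrite -horner_exp pE hornerD hornerM hornerX hornerC.
  by field.
have := HT (m ^- 2 *: S) 1 (leq_trans (size_scale_leq _ _) sS).
rewrite mul1r linearZ /= (riesz_represents wE sS).
have -> : \sum_(x <- xs) w x * S.[x] = - m ^+ 2 * \sum_(x <- xs) w x * x^-1.
  rewrite mulr_sumr; apply: eq_big_seq => x xxs.
  have x0 := xs_gt0 _ xxs; rewrite SE ?gt_eqF //.
  have /eqP -> : p.[x] == 0 by rewrite -/(root p x) root_prod_XsubC.
  by ring.
set W := \sum_(x <- xs) _.
have -> : m ^- 2 * (- m ^+ 2 * W) = - W by field.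
move=> h; suff : 0 <= - W + T by lra.
apply: h => t /andP[at_ _]; have t0 : 0 < t by exact: lt_le_trans at_.
rewrite hornerZ SE ?gt_eqF //.
have -> : m ^- 2 * ((p.[t] ^+ 2 - m ^+ 2) / t) + 1 / t = m ^- 2 * p.[t] ^+ 2 * t^-1.
  by field; rewrite m0 gt_eqF.
apply: mulr_ge0; last by rewrite invr_ge0 ltW.
by apply: mulr_ge0; rewrite ?invr_ge0 ?sqr_ge0.
Qed.

End RieszFunctional.

(** * Lagrange interpolation, orthogonal polynomials and Gauss quadrature *)

Section GaussQuadrature.
Variable R : realType.
Implicit Types (u v xs : seq R) (P Q p : {poly R}).

Definition lagrange_basis xs (x : R) : {poly R} :=
  let p := \prod_(y <- rem x xs) ('X - y%:P) in p.[x]^-1 *: p.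

Lemma horner_lagrange_basis xs x y : uniq xs -> x \in xs -> y \in xs ->
  (lagrange_basis xs x).[y] = (x == y)%:R.
Proof.
move=> uxs xxs yxs; rewrite /lagrange_basis; set p := \prod_(z <- _) _.
have rp z : root p z = (z \in rem x xs) by exact: root_prod_XsubC.
rewrite hornerZ; have [<-|xy] := eqVneq x y.
  by rewrite mulVf // -/(root p x) rp mem_rem_uniq // inE eqxx.
have /eqP -> : p.[y] == 0; last by rewrite mulr0.
by rewrite -/(root p y) rp mem_rem_uniq // inE eq_sym xy.
Qed.

Lemma size_lagrange_basis xs x : x \in xs -> (size (lagrange_basis xs x) <= size xs)%N.
Proof.
move=> xxs; rewrite (leq_trans (size_scale_leq _ _)) //.
by rewrite size_prod_XsubC size_rem //; case: xs xxs.
Qed.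

Lemma lagrange_interpolation xs P : uniq xs -> (size P <= size xs)%N ->
  P = \sum_(x <- xs) P.[x] *: lagrange_basis xs x.
Proof.
move=> uxs sP; apply/eqP; rewrite -subr_eq0; apply/eqP.
apply: (@roots_geq_poly_eq0 _ _ xs) => //.
- apply/allP => y yxs; rewrite /root hornerD hornerN horner_sum.
  rewrite (bigD1_seq y) //= hornerZ horner_lagrange_basis // eqxx mulr1.
  rewrite big_seq_cond big1 ?addr0 ?subrr // => x /andP[xxs xy].
  by rewrite hornerZ horner_lagrange_basis // (negPf xy) mulr0.
- rewrite (leq_trans (size_polyD _ _)) // geq_max sP size_polyN /=.
  rewrite (leq_trans (size_sum _ _ _)) //; apply/bigmax_leqP_seq => x xxs _.
  by rewrite (leq_trans (size_scale_leq _ _)) // size_lagrange_basis.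
Qed.

Lemma uniq_rem_notin xs : (forall x, x \in xs -> x \notin rem x xs) -> uniq xs.
Proof.
elim: xs => [//|y s IHs] h /=.
have ys : y \notin s by have := h y (mem_head _ _); rewrite /= eqxx.
rewrite ys IHs // => x xs; have := h x; rewrite inE xs orbT /= => /(_ isT).
case: eqP => [yx|_]; first by rewrite yx xs in ys.
by rewrite inE negb_or => /andP[].
Qed.

(* With [p(t) = (t - z) q(t)] and [z = a + ib], pairing with [Im q] gives
   [b L(|q|^2) = 0]; then pairing with [q] gives [a = L(t q^2) / L(q^2)]. *)
Lemma orthogonal_poly_split u K p : hankel_pos u -> size u = K.*2 ->
  size p = K.+1 -> p \is monic ->
  (forall P, (size P <= K)%N -> riesz u (p * P) = 0) ->
  exists xs, [/\ uniq xs, forall x, x \in xs -> 0 < x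
    & p = \prod_(x <- xs) ('X - x%:P)].
Proof.
move=> [upos uposX] su sp mp ortho.
have u_gt0 P : P != 0 -> (size P <= K)%N -> 0 < riesz u (P ^+ 2).
  by move=> P0 sP; apply: upos => //; lia.
have size_cofactor x Q : p = ('X - x%:P) * Q -> (size Q <= K)%N /\ Q != 0.
  move=> pE; have Q0 : Q != 0.
    by apply/eqP => Q0; move: sp; rewrite pE Q0 mulr0 size_poly0.
  split=> //; move: sp; rewrite pE size_monicM ?monicXsubC // size_XsubC.
  by rewrite add2n /= => -[->].
pose f := real_complex R.
have [zs] := closed_field_poly_normal (map_poly f p).
rewrite lead_coef_map (monicP mp) rmorph1 scale1r => pE.
have im0 z : z \in zs -> complex.Im z = 0.
  move=> zzs; have : root (map_poly f p) z by rewrite pE root_prod_XsubC.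
  move=> /factor_theorem[q qE].
  pose q1 := map_poly (@complex.Re R) q; pose q2 := map_poly (@complex.Im R) q.
  pose a := complex.Re z; pose b := complex.Im z.
  (* As [p] is real, the real and imaginary parts of [p = (t - z) q] are [re_eq] and [im_eq]. *)
  have coefq k : (p`_k)%:C%C = (if k == 0%N then 0 else q`_k.-1) - z * q`_k.
    have -> : (p`_k)%:C%C = (map_poly f p)`_k by rewrite coef_map.
    by rewrite qE mulrC mulrBl coefB coefXM coefCM.
  have c1 k : q1`_k = complex.Re q`_k by rewrite coef_map_id0.
  have c2 k : q2`_k = complex.Im q`_k by rewrite coef_map_id0.
  have re_eq : p = ('X - a%:P) * q1 + b *: q2.
    apply/polyP => k; rewrite mulrBl !coefD coefN coefXM coefCM coefZ !c1 !c2.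
    have := congr1 (@complex.Re R) (coefq k); rewrite /a /b.
    by case: (k == 0%N); case: (q`_k.-1) (q`_k) z {zzs qE a b coefq} => [? ?] [? ?] [? ?] /=; lra.
  have im_eq : ('X - a%:P) * q2 = b *: q1.
    apply/polyP => k; rewrite mulrBl !coefD coefN coefXM coefCM coefZ !c1 !c2.
    have := congr1 (@complex.Im R) (coefq k); rewrite /a /b.
    by case: (k == 0%N); case: (q`_k.-1) (q`_k) z {zzs qE a b coefq re_eq} => [? ?] [? ?] [? ?] /=; lra.
  have sq : (size q <= K)%N.
    have : size (map_poly f p) = size (q * ('X - z%:P)) by rewrite qE.
    have [->|q0] := eqVneq q 0; first by rewrite size_poly0.
    rewrite size_map_poly sp size_Mmonic ?monicXsubC // size_XsubC addn2 /=.
    by move=> [->].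
  have sq1 : (size q1 <= K)%N by rewrite (leq_trans (size_poly _ _)).
  have sq2 : (size q2 <= K)%N by rewrite (leq_trans (size_poly _ _)).
  apply/eqP/negPn/negP => b0; rewrite -/b in b0.
  have : riesz u (p * q2) = b * (riesz u (q1 ^+ 2) + riesz u (q2 ^+ 2)).
    rewrite re_eq mulrDl mulrAC im_eq -!scalerAl -!expr2 linearD !linearZ /=.
    by rewrite mulrDr.
  rewrite ortho // => /esym/eqP; rewrite mulf_eq0 (negPf b0) /=.
  (* Here [q1 = 0] would force [q2 = 0] by [im_eq], hence [p = 0]; so [L(q1^2) > 0]. *)
  have [q10|q10] := eqVneq q1 0.
    have := im_eq; rewrite q10 scaler0 => /eqP.
    rewrite mulf_eq0 polyXsubC_eq0 /= => /eqP q20.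
    move: sp; rewrite re_eq q10 q20 mulr0 scaler0 addr0 size_poly0.
    by [].
  have ge0 : 0 <= riesz u (q2 ^+ 2).
    have [->|q20] := eqVneq q2 0; first by rewrite expr0n linear0.
    exact/ltW/u_gt0.
  by rewrite gt_eqF // ltr_pwDl // u_gt0.
exists (map (@complex.Re R) zs).
set xs := map _ _.
have pE' : p = \prod_(x <- xs) ('X - x%:P).
  apply: (map_poly_inj f); rewrite pE rmorph_prod big_map.
  apply: eq_big_seq => z zzs; rewrite rmorphB /= map_polyX map_polyC /=.
  by have := im0 z zzs; case: (z) => [? ?] /= ->.
split=> //.
(* A double root would give [p = (t - x)^2 Q], and pairing [p] with [Q] would give
   [L(((t - x) Q)^2) = 0]. *)
- apply: uniq_rem_notin => x xxs; apply/negP => xrem.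
  pose Q := \prod_(y <- rem x (rem x xs)) ('X - y%:P).
  have pQ : p = ('X - x%:P) * (('X - x%:P) * Q).
    rewrite pE' (perm_big _ (perm_to_rem xxs)) big_cons.
    by rewrite (perm_big _ (perm_to_rem xrem)) big_cons.
  have [sQ Q0] := size_cofactor _ _ pQ.
  have /ortho : (size Q <= K)%N.
    move: sQ; rewrite size_monicM ?monicXsubC ?monic_neq0 ?monic_prod_XsubC //.
    by rewrite size_XsubC add2n => /ltnW.
  have -> : p * Q = (('X - x%:P) * Q) ^+ 2 by rewrite pQ; ring.
  by move=> e; have := u_gt0 _ Q0 sQ; rewrite e ltxx.
- move=> x xxs; have [q qE] : exists q, p = ('X - x%:P) * q.
    exists (\prod_(y <- rem x xs) ('X - y%:P)).
    by rewrite pE' (perm_big _ (perm_to_rem xxs)) big_cons.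
  have [sq q0] := size_cofactor _ _ qE.
  have := ortho q sq.
  have -> : p * q = 'X * q ^+ 2 - x *: q ^+ 2.
    by rewrite qE -mul_polyC; ring.
  rewrite linearB linearZ /= => /eqP; rewrite subr_eq0 => /eqP e.
  have Lq := u_gt0 _ q0 sq.
  by rewrite -(pmulr_lgt0 _ Lq) -e; apply: uposX => //; lia.
Qed.

(** With [g] representing [P -> L(X^K P)], the polynomial [p = X^K - g] is orthogonal to all degrees
    below [K]. Division by [p] then shows that interpolation at its roots integrates degrees up to
    [2K - 1] exactly. *)
Lemma gauss_quadrature u K : hankel_pos u -> size u = K.*2 ->
  exists xs (w : R -> R), [/\ uniq xs, size xs = K,
    forall x, x \in xs -> 0 < x, forall x, x \in xs -> 0 < w x
    & represents w xs u].
Proof.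
move=> upos su.
have u_gt0 P : P != 0 -> (size P <= K)%N -> 0 < riesz u (P ^+ 2).
  by move=> P0 sP; apply: upos.1 => //; lia.
have [g sg gE] := riesz_rep (drop K u) u_gt0.
pose p := 'X^K - g.
have sp : size p = K.+1 by rewrite size_polyDl ?size_polyXn // size_polyN.
have mp : p \is monic.
  by rewrite monicE lead_coefDl ?lead_coefXn // size_polyN size_polyXn.
have ortho P : (size P <= K)%N -> riesz u (p * P) = 0.
  by move=> sP; rewrite mulrBl linearB /= gE // riesz_drop subrr.
have [xs [uxs xs_gt0 pE]] := orthogonal_poly_split upos su sp mp ortho.
have sxs : size xs = K by move: sp; rewrite pE size_prod_XsubC => -[].
have quad P : (size P <= K.*2)%N ->
    riesz u P = \sum_(x <- xs) riesz u (lagrange_basis xs x) * P.[x].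
  move=> sP; rewrite {1}(divp_eq P p) linearD /= mulrC ortho; last first.
    by rewrite size_divp ?monic_neq0 // sp leq_subLR addnn.
  have sm : (size (P %% p)%R <= size xs)%N.
    by rewrite -ltnS sxs -sp ltn_modp monic_neq0.
  rewrite add0r [in LHS](lagrange_interpolation uxs sm) linear_sum.
  apply: eq_big_seq => x xxs /=; rewrite linearZ /= mulrC; congr (_ * _).
  rewrite {2}(divp_eq P p) hornerD hornerM.
  have /eqP -> : p.[x] == 0 by rewrite pE -/(root _ x) root_prod_XsubC.
  by rewrite mulr0 add0r.
exists xs, (fun x => riesz u (lagrange_basis xs x)); split=> // [x xxs|k ku].
  have l0 : lagrange_basis xs x != 0.
    apply/eqP => l0; have := horner_lagrange_basis uxs xxs xxs.
    by rewrite l0 horner0 eqxx => /esym/eqP; rewrite oner_eq0.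
  have sl := size_lagrange_basis xxs; rewrite sxs in sl.
  (* A Lagrange polynomial and its square agree at the nodes, and the degree [2K - 2] of the square
     is within the range of exactness. *)
  suff <- : riesz u (lagrange_basis xs x ^+ 2) = riesz u (lagrange_basis xs x) by exact: u_gt0.
  rewrite [LHS]quad; last by apply: size_sqr_le; lia.
  rewrite (bigD1_seq x) //= horner_exp horner_lagrange_basis // eqxx expr1n mulr1.
  rewrite big_seq_cond big1 ?addr0 // => y /andP[yxs yx].
  by rewrite horner_exp horner_lagrange_basis // eq_sym (negPf yx) expr0n mulr0.
have -> : u`_k = riesz u 'X^k.
  rewrite /riesz (bigD1 (Ordinal ku)) //= coefXn eqxx mul1r big1 ?addr0 // => j jk.
  by rewrite coefXn -[X in X == k]/(val j) -(inj_eq val_inj) /= in jk *; rewrite (negPf jk) mul0r.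
rewrite quad ?size_polyXn -?su //.
by apply: eq_bigr => x _; rewrite hornerXn.
Qed.

End GaussQuadrature.

(** * Integrals of polynomials and of [1/t] against a representing measure *)

Section MomentIntegrals.
Variable R : realType.
Implicit Types (u v xs : seq R) (P Q : {poly R}) (mu : {measure set R -> \bar R}).

Lemma measurable_fun_inv_itv (a b : R) : 0 < a ->
  measurable_fun `[a, b] (fun x : R => x^-1).
Proof.
move=> a0; apply: subspace_continuous_measurable_fun => //.
apply: continuous_in_subspaceT => x; rewrite inE /= in_itv /= => /andP[ax _].
by apply: inv_continuous; rewrite gt_eqF // (lt_le_trans a0).
Qed.

Lemma in_M_ab_finite (a b : R) u mu : (0 < size u)%N -> in_M_ab a b u mu ->
  (mu `[a, b]%classic < +oo)%E.
Proof.
move=> su [_ /(_ 0%N su)].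
under eq_integral do rewrite expr0.
by rewrite integral_cst // mul1e => ->; rewrite ltry.
Qed.

(** Turns a measure into the algebraic hypothesis of [hankel_pos_prepend] and [represents_inv_le].
    The integral of [1/t] is finite since [1/t <= 1/a] on [[a, b]] and the mass is [u_0]; then
    [Q + m/t] is integrated. *)
Lemma inv_integral_bound (a b : R) u mu : 0 < a -> (0 < size u)%N ->
  in_M_ab a b u mu ->
  exists2 T : R, (\int[mu]_(x in `[a, b]) (x^-1)%:E = T%:E)%E &
    forall Q (m : R), (size Q <= size u)%N ->
      (forall t, a <= t <= b -> 0 <= Q.[t] + m * t^-1) -> 0 <= riesz u Q + m * T.
Proof.
move=> a0 su mu_u; have muD := in_M_ab_finite su mu_u; case: mu_u => _ mom.
have D_gt0 x : `[a, b]%classic x -> 0 < x.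
  by rewrite /= in_itv /= => /andP[ax _]; exact: lt_le_trans ax.
have int_pow k : (k < size u)%N ->
    mu.-integrable `[a, b] (fun x : R => (x ^+ k)%:E).
  move=> ku; apply/integrableP; split.
    by apply/measurable_EFinP; exact: exprn_measurable.
  rewrite (eq_integral (fun x : R => (x ^+ k)%:E)) ?mom ?ltry //.
  by move=> x /[!inE] /D_gt0 x0; rewrite /= ger0_norm // exprn_ge0 // ltW.
have mV : measurable_fun `[a, b] (fun x : R => (x^-1)%:E).
  by apply/measurable_EFinP; exact: measurable_fun_inv_itv.
have Vge0 x : `[a, b]%classic x -> (0 <= (x^-1)%:E)%E.
  by move=> /D_gt0 x0; rewrite lee_fin invr_ge0 ltW.
have Vfin : (\int[mu]_(x in `[a, b]) (x^-1)%:E < +oo)%E.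
  apply: (@le_lt_trans _ _ (\int[mu]_(x in `[a, b]) (cst (a^-1)%:E x))%E).
    apply: ge0_le_integral => // x /=; rewrite in_itv /= => /andP[ax _].
    by rewrite lee_fin lef_pV2 // posrE // (lt_le_trans a0).
  by rewrite integral_cst // lte_mul_pinfty // lee_fin invr_ge0 ltW.
have int_V : mu.-integrable `[a, b] (fun x : R => (x^-1)%:E).
  apply/integrableP; split => //.
  rewrite (eq_integral (fun x : R => (x^-1)%:E)) //.
  by move=> x /[!inE] xD; rewrite gee0_abs // Vge0.
exists (fine (\int[mu]_(x in `[a, b]) (x^-1)%:E)%E).
  by rewrite fineK // ge0_fin_numE // integral_ge0.
move=> Q m sQ Qpos; rewrite -lee_fin.
pose f (k : 'I_(size u)) (x : R) : \bar R := ((Q`_k)%:E * (x ^+ k)%:E)%E.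
have int_f k : mu.-integrable `[a, b] (f k) by apply: integrableZl => //; exact: int_pow.
suff -> : (riesz u Q + m * fine (\int[mu]_(x in `[a, b]) (x^-1)%:E)%E)%:E =
    (\int[mu]_(x in `[a, b]) (\sum_(k < size u) f k x + m%:E * (x^-1)%:E))%E.
  apply: integral_ge0 => x xD; rewrite sumEFin -EFinM -EFinD lee_fin.
  by rewrite -horner_coef_wide // Qpos //; move: xD; rewrite /= in_itv.
rewrite integralD //; last by apply: integrableZl.
  rewrite integralZl // integral_sum // EFinD EFinM fineK; last first.
    by rewrite ge0_fin_numE // integral_ge0.
  congr (_ + _)%E; rewrite /riesz -sumEFin; apply: eq_bigr => k _.
  by rewrite integralZl ?mom //; exact: int_pow.
exact: integrable_sum.
Qed.

End MomentIntegrals.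

(** * Finitely atomic measures, supports and the value of [t_infty] *)

Section AtomicMeasures.
Variable R : realType.
Implicit Types (u v xs : seq R) (w : R -> R) (mu : {measure set R -> \bar R}).

(** The absolute value provides the nonnegative scalar that [mscale] expects without a proof about
    [w]; it disappears for nonnegative weights. *)
Definition atomic w xs : {measure set R -> \bar R} :=
  msum (fun i => mscale `|w xs`_i|%:nng (\d_(xs`_i))) (size xs).

Lemma atomicE w xs A :
  atomic w xs A = (\sum_(x <- xs) `|w x| * (x \in A)%:R)%:E.
Proof.
rewrite /atomic /= /msum (big_nth 0) big_mkord -sumEFin.
by apply: eq_bigr => i _; rewrite EFinM -(diracE R xs`_i A).
Qed.

Lemma integral_atomic w xs (D : set R) (f : R -> R) : measurable D ->
  measurable_fun D f -> (forall x, D x -> 0 <= f x) ->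
  (\int[atomic w xs]_(x in D) (f x)%:E =
    (\sum_(x <- xs) `|w x| * (x \in D)%:R * f x)%:E)%E.
Proof.
move=> mD mf f0; have mfE : measurable_fun D (EFin \o f) by exact/measurable_EFinP.
rewrite ge0_integral_measure_sum //.
rewrite (big_nth 0) big_mkord -sumEFin; apply: eq_bigr => i _.
rewrite ge0_integral_mscale //.
by rewrite integral_dirac // diracE /= -!EFinM mulrA.
Qed.

Lemma separation (x : R) xs :
  exists2 e : R, 0 < e & forall y, y \in xs -> y != x -> y \notin `](x - e), (x + e)[.
Proof.
elim: xs => [|y s [e e0 IHs]]; first by exists 1.
have [yx|yx] := eqVneq y x.
  by exists e => // z; rewrite in_cons => /orP[/eqP ->|/IHs //]; rewrite yx eqxx.
exists (Order.min e `|y - x|); first by rewrite lt_min e0 normr_gt0 subr_eq0.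
move=> z; rewrite in_cons => /orP[/eqP -> _|zs zx].
  rewrite in_itv /= -ltr_distl distrC ltNge negbK.
  by rewrite distrC ge_min lexx orbT.
apply: contra (IHs z zs zx); rewrite !in_itv /= -!ltr_distl => /lt_le_trans; apply.
by rewrite ge_min lexx.
Qed.

Lemma msupp_atomic w xs : (forall x, x \in xs -> 0 < w x) ->
  msupp (atomic w xs) = [set` xs].
Proof.
move=> w0; apply/seteqP; split=> x /=.
  move=> h; apply/negPn/negP => xxs; have [e e0 sep] := separation x xs.
  have := h e e0; rewrite atomicE big_seq big1 ?ltxx // => y yxs.
  have yx : y != x by apply: contraNneq xxs => <-.
  by rewrite memNset ?mulr0 //=; exact/negP/sep.
move=> xxs e e0; rewrite atomicE lte_fin (perm_big _ (perm_to_rem xxs)) big_cons.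
apply: ltr_pwDl; last by apply: sumr_ge0 => y _; rewrite mulr_ge0.
rewrite mem_set /= ?mulr1 ?normr_gt0 ?gt_eqF ?w0 //.
by rewrite in_itv /= ltrBlDr ltrDl e0.
Qed.

(** Every point outside the support lies in a null open interval with rational endpoints, and there
    are countably many of these. *)
Lemma negligible_setC_msupp mu : mu.-negligible (~` msupp mu).
Proof.
(* Enumerates the rational intervals, with the empty set in place of those of nonzero mass. *)
pose F (k : nat) : set R := if unpickle k is Some (p, q)
  then (if mu `](ratr p), (ratr q)[%classic == 0%E then `](ratr p), (ratr q)[%classic else set0)
  else set0.
apply: (@negligibleS _ _ _ _ (\bigcup_k F k)); last first.
  apply: negligible_bigcup => k; rewrite /F.
  case: unpickle => [[p q]|]; last exact: negligible_set0.
  case: eqP => [h|_]; last exact: negligible_set0.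
  by apply/negligibleP.
move=> x /= /existsNP[e /not_implyP[e0]] /negP.
rewrite -leNgt measure_le0 => /eqP mu0.
have [p] : exists p, ratr p \in `](x - e), x[ by apply: rat_in_itvoo; lra.
rewrite in_itv /= => /andP[p1 p2].
have [q] : exists q, ratr q \in `]x, (x + e)[ by apply: rat_in_itvoo; lra.
rewrite in_itv /= => /andP[q1 q2].
exists (pickle (p, q)); [by []|rewrite /F pickleK].
have -> : mu `](ratr p), (ratr q)[%classic = 0%E.
  apply/eqP; rewrite -measure_le0 -mu0; apply: le_measure; rewrite ?inE //.
  by apply: subset_itv; rewrite bnd_simp ltW.
by rewrite eqxx /= in_itv /= p2 q1.
Qed.

Lemma measurable_seq xs : measurable [set` xs].
Proof.
apply: countable_measurable => [t|]; first exact: measurable_set1.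
exact/finite_set_countable/finite_seq.
Qed.

(** The complement of [xs] is null, so [mu] is the sum of its point masses; finiteness of [mu] lets
    [fine] recover them. *)
Lemma measure_finite_msupp mu xs (A : set R) :
  (mu setT < +oo)%E -> uniq xs -> msupp mu `<=` [set` xs] -> measurable A ->
  mu A = atomic (fun x => fine (mu [set x])) xs A.
Proof.
move=> mufin uxs sub mA.
have mxs := measurable_seq.
have mu0 : mu (~` [set` xs]) = 0%E.
  apply: measure_negligible; first exact: measurableC.
  by apply: negligibleS (negligible_setC_msupp mu); exact: subsetC.
have -> : mu A = mu (A `&` [set` xs]).
  rewrite -[in LHS](setIT A) -(setUv [set` xs]) setIUr measureU //.
  - rewrite [X in (_ + X)%E](_ : _ = 0%E) ?adde0 //.
    apply/eqP; rewrite -measure_le0 -mu0; apply: le_measure; rewrite ?inE //.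
      by apply: measurableI => //; exact: measurableC.
    exact: measurableC.
  - exact: measurableI.
  - by apply: measurableI => //; exact: measurableC.
  - by rewrite setIACA setICr setI0.
rewrite atomicE; elim: xs uxs {sub mu0} => [_|y s IHs /= /andP[ys us]].
  rewrite big_nil (_ : [set` [::]] = set0) ?setI0 ?measure0 //.
  by apply/seteqP; split.
have -> : [set` y :: s] = [set y] `|` [set` s].
  apply/seteqP; split=> z /=; rewrite inE.
    by move=> /orP[/eqP ->|]; [left|right].
  by move=> [->|->]; rewrite ?eqxx ?orbT.
rewrite setIUr measureU; last first.
- apply/seteqP; split=> // z [[_ /= ->] [_ /= yin]].
  by rewrite yin in ys.
- exact: measurableI.
- exact: measurableI.
rewrite big_cons EFinD; congr (_ + _)%E; last exact: IHs.
have fin : mu [set y] \is a fin_num.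
  rewrite ge0_fin_numE //; apply: le_lt_trans mufin.
  by apply: le_measure; rewrite ?inE.
have [yA|yA] := boolP (y \in A).
  rewrite mulr1 ger0_norm ?fine_ge0 // fineK // setIidr // => z /= ->.
  by rewrite inE in yA.
rewrite mulr0 (_ : A `&` [set y] = set0) ?measure0 //.
apply/seteqP; split=> // z [/= zA zy]; move: yA; rewrite -zy.
by rewrite mem_set.
Qed.

Lemma in_M_ab_finiteT (a b : R) u mu : (0 < size u)%N -> in_M_ab a b u mu ->
  (mu setT < +oo)%E.
Proof.
move=> su mu_u; have fin := in_M_ab_finite su mu_u; case: mu_u => mu0 _.
have mC : measurable (~` `[a, b]%classic : set R) by exact: measurableC.
rewrite -(setUv `[a, b]%classic) measureU ?setICr //.
by rewrite [X in (_ + X)%E]mu0 adde0.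
Qed.

Lemma in_M_ab_represents (a b : R) u mu xs : 0 < a -> (0 < size u)%N ->
  in_M_ab a b u mu -> uniq xs -> msupp mu `<=` [set` xs] ->
  represents (fun x => fine (mu [set x])) xs u.
Proof.
move=> a0 su mu_u uxs sub k ku.
have fin := in_M_ab_finiteT su mu_u.
have [mu0 /(_ k ku)] := mu_u.
rewrite (eq_measure_integral (atomic (fun x => fine (mu [set x])) xs)); last first.
  by move=> A mA _; exact: measure_finite_msupp.
rewrite integral_atomic //; last first.
  move=> x /=; rewrite in_itv /= => /andP[ax _].
  by rewrite exprn_ge0 // (le_trans (ltW a0)).
move=> -[<-]; apply: eq_bigr => x _; congr (_ * _).
rewrite ger0_norm ?fine_ge0 //.
(* The list [xs] may contain points outside [[a, b]], but they have mass 0. *)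
have [xD|xD] := boolP (x \in `[a, b]%classic); first by rewrite mulr1.
rewrite mulr0 (_ : mu [set x] = 0%E) //.
apply/eqP; rewrite -measure_le0 -mu0; apply: le_measure; rewrite ?inE //.
  exact: measurableC.
by move=> z /= -> zD; move: xD; rewrite mem_set.
Qed.

(** An interval around [x] that avoids the other atoms has positive mass, all of it at [x]. *)
Lemma msupp_weight_gt0 mu xs x : (mu setT < +oo)%E -> uniq xs ->
  msupp mu = [set` xs] -> x \in xs -> 0 < fine (mu [set x]).
Proof.
move=> fin uxs suppE xxs; have [e e0 sep] := separation x xs.
have : msupp mu x by rewrite suppE.
move=> /(_ e e0); rewrite (measure_finite_msupp fin uxs) ?suppE //.
rewrite atomicE lte_fin (bigD1_seq x) //= [X in _ + X]big_seq_cond.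
rewrite [X in _ + X]big1 ?addr0; last first.
  by move=> y /andP[yxs yx]; rewrite memNset ?mulr0 //=; exact/negP/sep.
rewrite mem_set /= ?mulr1 ?ger0_norm ?fine_ge0 //.
by rewrite in_itv /= ltrBlDr ltrDl e0.
Qed.

Lemma seq_pos_bounds xs : (forall x, x \in xs -> 0 < x) ->
  exists a b : R, [/\ 0 < a, a < b & forall x, x \in xs -> a <= x <= b].
Proof.
elim: xs => [|y s IHs] h; first by exists 1, 2; split=> //; lra.
have [|a [b [a0 ab H]]] := IHs; first by move=> x xs; apply: h; rewrite inE xs orbT.
have y0 := h y (mem_head _ _).
exists (Order.min a y), (Order.max b y); split.
- by rewrite lt_min a0 y0.
- by rewrite gt_min lt_max ab.
- move=> x; rewrite inE ge_min le_max => /orP[/eqP ->|/H /andP[-> ->] //].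
  by rewrite lexx !orbT.
Qed.

Lemma atomic_in_M_ab (a b : R) w xs u : 0 < a ->
  (forall x, x \in xs -> a <= x <= b) -> (forall x, x \in xs -> 0 <= w x) ->
  represents w xs u -> in_M_ab a b u (atomic w xs).
Proof.
move=> a0 xs_ab w0 wE; split.
  rewrite atomicE big_seq big1 // => x /xs_ab xab.
  by rewrite memNset ?mulr0 //=; apply; rewrite in_itv.
move=> k ku; rewrite integral_atomic //; last first.
  move=> x /=; rewrite in_itv /= => /andP[ax _].
  by rewrite exprn_ge0 // (le_trans (ltW a0)).
rewrite wE //; congr (_%:E); apply: eq_big_seq => x xxs.
by rewrite ger0_norm ?w0 // mem_set ?mulr1 //= in_itv /= xs_ab.
Qed.

(** The atomic measure itself competes in the infimum, and [represents_inv_le] bounds every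
    competitor from below. The latter needs [2 * size xs] moments. *)
Lemma t_infty_represents w xs v : (0 < size v)%N -> (size xs * 2 <= size v)%N ->
  (forall x, x \in xs -> 0 < x) -> (forall x, x \in xs -> 0 < w x) ->
  represents w xs v ->
  t_infty v = (\sum_(x <- xs) w x * x^-1)%:E.
Proof.
move=> sv sxs xs_gt0 w_gt0 wE; apply/eqP; rewrite eq_le; apply/andP; split.
  have [a [b [a0 ab xs_ab]]] := seq_pos_bounds xs_gt0.
  apply: (@le_trans _ _ (t_ab a b v)).
    by apply: ereal_inf_lbound; exists a, b.
  apply: ereal_inf_lbound; exists (atomic w xs).
    by apply: atomic_in_M_ab => // x /w_gt0/ltW.
  rewrite integral_atomic //; last 2 first.
  - exact: measurable_fun_inv_itv.
  - move=> x /=; rewrite in_itv /= => /andP[ax _].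
    by rewrite invr_ge0 (le_trans (ltW a0)).
  congr (_%:E); apply: eq_big_seq => x xxs.
  by rewrite gtr0_norm ?w_gt0 // mem_set ?mulr1 //= in_itv /= xs_ab.
apply: le_ereal_inf_tmp => _ [a [b [a0 [ab ->]]]].
apply: le_ereal_inf_tmp => _ [mu /= mu_v <-].
have [T -> HT] := inv_integral_bound a0 sv mu_v.
by rewrite lee_fin; exact: represents_inv_le HT.
Qed.

(** A strict inequality against the infimum produces one measure whose integral of [1/t] is below
    [c]. *)
Lemma t_infty_lt_hankel_pos v c : (0 < size v)%N -> hankel_pos v ->
  (t_infty v < c%:E)%E -> hankel_pos (c :: v).
Proof.
move=> sv hv /ereal_inf_lt[_ [a [b [a0 [ab ->]]]]] /ereal_inf_lt[_ [mu /= mu_v <-]].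
have [T -> HT] := inv_integral_bound a0 sv mu_v.
by rewrite lte_fin; exact: hankel_pos_prepend HT.
Qed.

End AtomicMeasures.

(** * Shifted moment sequences, the determinant [Q] and the lower bound on the number of atoms *)

Section MomentSequences.
Variable R : realType.
Implicit Types (u v xs : seq R) (w : R -> R) (s : int -> R).
Implicit Types (mu : {measure set R -> \bar R}).

Lemma sqS s (k : int) len : sq s k len.+1 = s k :: sq s (k + 1) len.
Proof.
rewrite /sq /mkseq /= addr0 (iotaDl 1 0 len) -map_comp; congr cons.
by apply: eq_map => i /=; congr s; lia.
Qed.

Lemma drop_sq s (k : int) d len : drop d (sq s k (d + len)) = sq s (k + d%:Z) len.
Proof.
elim: d k => [|d IHd] k; first by rewrite drop0 addr0.
by rewrite addSn sqS /= IHd; congr sq; lia.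
Qed.

Lemma represents_cons w xs v c : (forall x, x \in xs -> x != 0) ->
  represents w xs v -> c = \sum_(x <- xs) w x * x^-1 ->
  represents (fun x => w x * x^-1) xs (c :: v).
Proof.
move=> xs0 wE cE [|k] /= kv; first by rewrite cE; under [RHS]eq_bigr do rewrite mulr1.
rewrite wE //; apply: eq_big_seq => x /xs0 x0.
by rewrite exprS -mulrA mulKf.
Qed.

Lemma represents_behead w xs v c : represents w xs (c :: v) ->
  represents (fun x => w x * x) xs v.
Proof.
move=> wE k kv; rewrite -[LHS]/((c :: v)`_k.+1) wE //.
by apply: eq_bigr => x _; rewrite exprS mulrA.
Qed.

(** The value of [riesz u] at the Lagrange polynomial of [x] is the weight at [x]. *)
Lemma represents_uniq w w' xs u : uniq xs -> (size xs <= size u)%N ->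
  represents w xs u -> represents w' xs u -> {in xs, w =1 w'}.
Proof.
move=> uxs sxs wE wE' x xxs.
have sl := leq_trans (size_lagrange_basis xxs) sxs.
have weightE w0 : represents w0 xs u -> riesz u (lagrange_basis xs x) = w0 x.
  move=> w0E; rewrite (riesz_represents w0E sl) (bigD1_seq x) //=.
  rewrite horner_lagrange_basis // eqxx mulr1 big_seq_cond big1 ?addr0 //.
  by move=> y /andP[yxs yx]; rewrite horner_lagrange_basis // eq_sym (negPf yx) mulr0.
by rewrite -(weightE _ wE) (weightE _ wE').
Qed.

(* A row vector killed by the matrix is a polynomial of degree at most [K] that
   vanishes at [t] and is orthogonal to lower degrees, i.e. vanishes at the atoms. *)
Lemma Qdet_eq0 s (r K : nat) u w xs t :
  (forall k, (k < K.*2)%N -> u`_k = s (- r%:Z + k%:Z)) ->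
  (K.*2 <= size u)%N -> uniq xs -> size xs = K ->
  (forall x, x \in xs -> w x != 0) -> represents w xs u ->
  (Qdet s r K t == 0) = (t \in xs).
Proof.
move=> uE su uxs sxs w0 wE; rewrite /Qdet; set M := \matrix_(i, j) _.
have horner_rVpolyE (c : 'rV[R]_K.+1) x : (rVpoly c).[x] = \sum_(i < K.+1) c 0 i * x ^+ i.
  rewrite rVpoly_sum horner_sum; apply: eq_bigr => i _.
  by rewrite hornerZ hornerXn.
have cM (c : 'rV[R]_K.+1) (j : 'I_K.+1) : (c *m M) 0 j =
    if (j < K)%N then \sum_(x <- xs) w x * ((rVpoly c).[x] * x ^+ j)
    else (rVpoly c).[t].
  rewrite mxE; case: ifPn => jK; last first.
    by rewrite horner_rVpolyE; apply: eq_bigr => i _; rewrite mxE (negPf jK).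
  transitivity (\sum_(i < K.+1) c 0 i * \sum_(x <- xs) w x * x ^+ (i + j)).
    apply: eq_bigr => i _; rewrite mxE jK; congr (_ * _).
    have ij : (i + j < K.*2)%N by have := ltn_ord i; lia.
    by rewrite -wE ?(leq_trans ij) // uE // PoszD addrA.
  under eq_bigr do rewrite mulr_sumr.
  rewrite exchange_big; apply: eq_bigr => x _ /=.
  rewrite horner_rVpolyE mulr_suml mulr_sumr; apply: eq_bigr => i _.
  by rewrite exprD; ring.
apply/idP/idP => [/det0P[c c0 cM0]|txs].
  pose C := rVpoly c.
  have C0 : C != 0 by apply: contra c0 => /eqP e; rewrite -[c]rVpolyK -/C e linear0.
  have Ct : C.[t] = 0.
    by have := cM c ord_max; rewrite /= ltnn cM0 mxE => <-.
  have Cx x : x \in xs -> C.[x] = 0.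
    move=> xxs.
    (* The first [K] columns test [C] against monomials; linearity allows the Lagrange polynomials,
       which isolate [w x * C.[x]]. *)
    have pair (P : {poly R}) : (size P <= K)%N -> \sum_(y <- xs) w y * (C.[y] * P.[y]) = 0.
      move=> sP; transitivity (\sum_(j < K) P`_j * (c *m M) 0 (widen_ord (leqnSn K) j)).
        under [RHS]eq_bigr => j _ do rewrite cM /= ltn_ord mulr_sumr.
        rewrite exchange_big; apply: eq_bigr => y _ /=.
        rewrite (horner_coef_wide y sP) !mulr_sumr; apply: eq_bigr => j _.
        by ring.
      by rewrite cM0 big1 // => j _; rewrite mxE mulr0.
    have sl := size_lagrange_basis xxs; rewrite sxs in sl.
    have := pair _ sl; rewrite (bigD1_seq x) //= horner_lagrange_basis // eqxx mulr1.
    rewrite [X in _ + X]big_seq_cond [X in _ + X]big1 ?addr0; last first.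
      move=> y /andP[yxs yx]; rewrite horner_lagrange_basis // eq_sym (negPf yx).
      by rewrite !mulr0.
    by move=> /eqP; rewrite mulf_eq0 (negPf (w0 _ xxs)) => /eqP.
  (* Otherwise [C], of degree at most [K], would have the [K + 1] distinct roots [t :: xs]. *)
  apply/negPn/negP => txs; move: C0; rewrite (@roots_geq_poly_eq0 _ C (t :: xs)) ?eqxx //=.
  - by rewrite /root Ct eqxx /=; apply/allP => x /Cx /eqP.
  - by rewrite txs.
  - by rewrite sxs size_poly.
pose p := \prod_(x <- xs) ('X - x%:P).
have sp : size p = K.+1 by rewrite size_prod_XsubC sxs.
have px x : x \in xs -> p.[x] = 0 by move=> xxs; apply/eqP; rewrite -/(root p x) root_prod_XsubC.
have pK : rVpoly (poly_rV p : 'rV_K.+1) = p by rewrite poly_rV_K ?sp.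
apply/det0P; exists (poly_rV p).
  apply/eqP => e; move: sp; rewrite -pK e linear0 size_poly0; discriminate.
apply/rowP => j; rewrite cM mxE pK px // big_seq big1 ?if_same // => x xxs.
by rewrite px // mul0r mulr0.
Qed.

Lemma positive_infty_represents w xs u : (forall x, x \in xs -> 0 < x) ->
  (forall x, x \in xs -> 0 < w x) -> represents w xs u -> positive_infty u.
Proof.
move=> xs_gt0 w_gt0 wE; have [a [b [a0 ab xs_ab]]] := seq_pos_bounds xs_gt0.
exists a, b; split=> //; split=> // P sP Ppos.
rewrite (riesz_represents wE sP) big_seq; apply: sumr_ge0 => x xxs.
by rewrite mulr_ge0 ?Ppos ?xs_ab // ltW ?w_gt0.
Qed.

(** Positivity is only available for a tail of [u], so the test polynomial is [X^d p^2] with [p]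
    vanishing at the atoms: its integral is 0, yet it equals the tail functional at [p^2]. *)
Lemma hankel_pos_supp_card d K u mu m : hankel_pos (drop d u) ->
  (d + K.*2 <= (size u).+1)%N -> (0 < size u)%N -> in_M_infty u mu ->
  supp_card_le mu m -> (K <= m)%N.
Proof.
move=> hpos sdu su [a [b [a0 [ab mu_u]]]] [ys [sys suppE]].
rewrite leqNgt; apply/negP => mK; pose zs := undup ys.
have szs : (size zs < K)%N by rewrite (leq_ltn_trans (size_undup ys)) ?(leq_ltn_trans sys).
have wE : represents (fun x => fine (mu [set x])) zs u.
  apply: (in_M_ab_represents a0 su mu_u); first exact: undup_uniq.
  by move=> x /suppE /=; rewrite mem_undup.
pose p := \prod_(z <- zs) ('X - z%:P).
have sp : size p = (size zs).+1 by exact: size_prod_XsubC.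
have p0 : p != 0 by rewrite -size_poly_eq0 sp.
have := hpos.1 p p0; rewrite size_drop sp => /(_ ltac:(lia)).
have sp2 : (size (p ^+ 2)%R <= (size zs).*2.+1)%N by apply: size_sqr_le; rewrite sp; lia.
rewrite riesz_drop (riesz_represents wE); last first.
  have := size_polyMleq 'X^d (p ^+ 2); rewrite size_polyXn => /leq_trans; apply.
  by move: sp2; lia.
rewrite big_seq big1 ?ltxx // => z zzs; rewrite hornerM !horner_exp.
have /eqP -> : p.[z] == 0 by rewrite -/(root p z) root_prod_XsubC.
by rewrite expr0n /= !mulr0.
Qed.

End MomentSequences.

(** * Prepending the negative moments, the index and uniqueness *)

Theorem theorem5p7 (R : realType) (n r K : nat) (s : int -> R) :
  (forall k : int, - (r%:Z) <= k <= n%:Z -> 0 <= s k) ->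
  strictly_positive_infty (sq s 0 n.+1) ->
  (1 <= r)%N ->
  (n.+2 %/ 2 <= K <= (n + r).+2 %/ 2)%N ->
  let N := (K.*2).-1 in
  (forall k : int, - (r%:Z) <= k -> n%:Z - N%:Z <= k -> k <= -1 ->
     (t_infty (sq s (k + 1) (absz (n%:Z - k))) < (s k)%:E)%E) ->
  (forall k : int, - (r%:Z) <= k -> k <= n%:Z - N%:Z - 1 ->
     (s k)%:E = t_infty (sq s (k + 1) N.+1)) ->
  let s' := sq s (- (r%:Z)) (n + r).+1 in
  positive_infty s' /\ ind_infty_eq s' K /\
  ((N <= n + r)%N ->
    (forall mu1 mu2 : {measure set R -> \bar R},
        in_M_infty s' mu1 -> supp_card mu1 K ->
        in_M_infty s' mu2 -> supp_card mu2 K ->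
        forall A : set R, measurable A -> mu1 A = mu2 A) /\
    (forall mu : {measure set R -> \bar R},
        in_M_infty s' mu -> supp_card mu K ->
        msupp mu = [set t : R | Qdet s r K t = 0])).
Proof.
move=> _ s_pos r_gt0 /andP[K1 K2] N Hlt Heq s'.
have K_gt0 : (0 < K)%N by lia.
have nN : (n <= N)%N by rewrite /N; lia.
have Nnr : (N <= (n + r).+1)%N by rewrite /N; lia.
have NK : N.+1 = K.*2 by rewrite /N; lia.
have ss' : size s' = (n + r).+1 by exact: size_mkseq.
have sqN j : sq s (- (j.+1)%:Z) (n + j.+1).+1 =
    s (- (j.+1)%:Z) :: sq s (- j%:Z) (n + j).+1.
  by rewrite addnS sqS; congr (_ :: sq _ _ _); lia.
(* Condition (i) governs the first [N - n] prepended terms, each exceeding [t_infty] of all terms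
   after it. *)
have hpos j : (j <= r)%N -> (j <= N - n)%N -> hankel_pos (sq s (- j%:Z) (n + j).+1).
  elim: j => [_ _|j IHj jr jN].
    by rewrite oppr0 addn0; exact: strictly_positive_hankel.
  rewrite sqN; apply: t_infty_lt_hankel_pos.
  - by rewrite size_mkseq.
  - by apply: IHj; lia.
  - have := Hlt (- (j.+1)%:Z).
    have -> : - (j.+1)%:Z + 1 = - j%:Z by lia.
    have -> : `|n%:Z - - (j.+1)%:Z|%N = (n + j).+1 by lia.
    by apply; lia.
(* The number of terms prepended under (i). The block from [-j0] to [n] has [2K] terms if
   [N <= n + r], and [2K - 1] terms otherwise. *)
pose j0 := minn r (N - n).
have j0r : (j0 <= r)%N by exact: geq_minl.
have sj0 : (K.*2 <= (n + j0).+2)%N by rewrite /j0; lia.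
have hj0 : hankel_pos (sq s (- j0%:Z) (n + j0).+1) by apply: hpos => //; exact: geq_minr.
have [xs [w [uxs sxs xs_gt0 w_gt0 wE]]] : exists xs (w : R -> R),
    [/\ uniq xs, size xs = K, forall x, x \in xs -> 0 < x,
      forall x, x \in xs -> 0 < w x & represents w xs s'].
  (* If [N = n + r + 1], then [s'] has [2K - 1] terms: one moment is added in front, and the Gauss
     measure [mu] of the longer sequence is replaced by [t mu]. *)
  have [Nle|Ngt] := leqP N (n + r); last first.
    have [c hc] : exists c, hankel_pos (c :: s').
      apply: hankel_pos_extend; first by rewrite size_mkseq; lia.
      by apply: hpos => //; lia.
    have [|xs [w [uxs sxs xs_gt0 w_gt0 wE]]] := gauss_quadrature (K := K) hc.
      by rewrite -[LHS]/((size s').+1) ss'; lia.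
    exists xs, (fun x => w x * x); split=> //; last exact: represents_behead wE.
    by move=> x xxs; rewrite mulr_gt0 ?w_gt0 ?xs_gt0.
  have j0E : j0 = (N - n)%N by rewrite /j0; lia.
  have [|xs [w [uxs sxs xs_gt0 w_gt0 wE]]] := gauss_quadrature (K := K) hj0.
    by rewrite size_mkseq; lia.
  (* Induction over the terms governed by (ii): the atoms stay fixed and each step divides the
     weights by [x]. *)
  suff H d : (j0 + d <= r)%N -> exists w' : R -> R, (forall x, x \in xs -> 0 < w' x) /\
      represents w' xs (sq s (- (j0 + d)%:Z) (n + (j0 + d)).+1).
    have [|w' [w'_gt0 w'E]] := H (r - j0)%N; first by rewrite subnKC.
    by exists xs, w'; split=> //; rewrite subnKC // in w'E.
  elim: d => [_|d IHd dr]; first by exists w; rewrite addn0.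
  have [|w' [w'_gt0 w'E]] := IHd; first lia.
  exists (fun x => w' x * x^-1); split.
    by move=> x xxs; rewrite mulr_gt0 ?invr_gt0 ?w'_gt0 ?xs_gt0.
  rewrite addnS sqN; apply: represents_cons => //.
    by move=> x /xs_gt0 x0; rewrite gt_eqF.
  apply: EFin_inj; rewrite Heq; [|lia|lia].
  have -> : - (j0 + d).+1%:Z + 1 = - (j0 + d)%:Z by lia.
  (* The window in (ii) is a prefix of the sequence already represented, and its [N + 1 = 2K] terms
     are just enough for [K] atoms. *)
  apply: t_infty_represents => //; rewrite ?size_mkseq //; first by lia.
  move=> k; rewrite size_mkseq => kN.
  have kn : (k < (n + (j0 + d)).+1)%N by lia.
  by rewrite -w'E ?size_mkseq // !nth_mkseq.
have s'_gt0 : (0 < size s')%N by rewrite ss'.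
split; first exact: positive_infty_represents wE.
split.
  split.
    exists (atomic w xs); split; last by exists xs; rewrite msupp_atomic.
    have [a [b [a0 ab xs_ab]]] := seq_pos_bounds xs_gt0.
    exists a, b; split=> //; split=> //.
    by apply: atomic_in_M_ab => // x /w_gt0/ltW.
  (* Dropping the [r - j0] terms governed by (ii) leaves the Hankel positive block that starts at
     [-j0]. *)
  move=> mu m mu_s' le_m; apply: (@hankel_pos_supp_card _ (r - j0)) mu_s' le_m => //.
    have -> : s' = sq s (- r%:Z) ((r - j0) + (n + j0).+1) by congr sq; lia.
    by rewrite drop_sq; have -> : - r%:Z + (r - j0)%:Z = - j0%:Z by lia.
  by rewrite ss'; lia.
move=> Nle.
(* The zeros of [Q] depend on [s] alone, so all [K]-atomic measures share their atoms; the moments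
   then fix the weights. *)
have atoms mu : in_M_infty s' mu -> supp_card mu K -> exists ys,
    [/\ uniq ys /\ size ys = K, msupp mu = [set` ys], (mu setT < +oo)%E,
      represents (fun x => fine (mu [set x])) ys s'
      & forall t, (Qdet s r K t == 0) = (t \in ys)].
  move=> [a [b [a0 [ab mu_s']]]] [ys [uys [sys suppE]]].
  have fin := in_M_ab_finiteT s'_gt0 mu_s'.
  have rep : represents (fun x => fine (mu [set x])) ys s'.
    by apply: (in_M_ab_represents a0 s'_gt0 mu_s' uys); rewrite suppE.
  exists ys; split=> // t; apply: (Qdet_eq0 (u := s')) rep => //.
  - by move=> k kK; rewrite nth_mkseq //; lia.
  - by rewrite ss'; lia.
  - by move=> x xys; rewrite gt_eqF // (msupp_weight_gt0 fin uys suppE).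
split=> [mu1 mu2 mu1s' card1 mu2s' card2 A mA|mu mus' card].
  have [ys1 [[u1 sz1] supp1 fin1 rep1 Q1]] := atoms _ mu1s' card1.
  have [ys2 [[u2 _] supp2 fin2 rep2 Q2]] := atoms _ mu2s' card2.
  have ys12 : ys1 =i ys2 by move=> t; rewrite -Q1 Q2.
  have supp2' : msupp mu2 = [set` ys1].
    by rewrite supp2; apply/seteqP; split=> t /=; rewrite ys12.
  have rep2' : represents (fun x => fine (mu2 [set x])) ys1 s'.
    by move=> k ks; rewrite rep2 //; apply/perm_big/uniq_perm.
  have w12 : {in ys1, (fun x => fine (mu1 [set x])) =1 (fun x => fine (mu2 [set x]))}.
    by apply: represents_uniq rep1 rep2' => //; rewrite sz1 ss'; lia.
  rewrite (measure_finite_msupp fin1 u1) ?supp1 //.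
  rewrite (measure_finite_msupp fin2 u1) ?supp2' //.
  by rewrite !atomicE; congr (_%:E); apply: eq_big_seq => x xys; rewrite w12.
have [ys [_ -> _ _ Q]] := atoms _ mus' card.
by apply/seteqP; split=> t /=; rewrite -Q => /eqP.
Qed.
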